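(* Let $A\ge0$, $B\in\mathbb{R}$, $\tilde p(z)=A\,\frac{1+z}{1-z}+B\,i$ (so that $\tilde p(0)=A+Bi$), and let $k\in\mathbb{R}$. Let $\{\psi_t\}_{t\ge0}$ be the semigroup of automorphisms of $\mathbb{D}$ defined by $$\frac{d}{dt}\psi_t(z)=(\psi_t(z)-1)^2\,\tilde p(\psi_t(z))-ik\,\psi_t(z),\qquad \psi_0(z)=z,\quad z\in\mathbb{D},\ t\ge 0.$$ Then $\psi_t$ is: - hyperbolic, if $2\left(-\operatorname{Im}\tilde p(0)-|\tilde p(0)|\right)<k<2\left(-\operatorname{Im}\tilde p(0)+|\tilde p(0)|\right)$; - parabolic, if $k=2\left(-\operatorname{Im}\tilde p(0)\pm|\tilde p(0)|\right)$; - elliptic, if $k<2\left(-\operatorname{Im}\tilde p(0)-|\tilde p(0)|\right)$ or $k>2\left(-\operatorname{Im}\tilde p(0)+|\tilde p(0)|\right)$.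
   Context: $\mathbb{D}$ is the open unit disk and $\mathbb{T}$ the unit circle. A holomorphic self-map $\varphi$ of $\mathbb{D}$ is called elliptic if it has a fixed point $\tau\in\mathbb{D}$; this point is then called its Denjoy-Wolff point. Otherwise there is a point $\tau\in\mathbb{T}$, again called the Denjoy-Wolff point of $\varphi$, such that the angular limit $\angle\lim_{z\to\tau}\varphi(z)$ equals $\tau$ and the angular limit $\alpha_\varphi=\angle\lim_{z\to\tau}\varphi'(z)$ exists and belongs to $(0,1]$; in this case $\varphi$ is called hyperbolic if $\alpha_\varphi<1$ and parabolic if $\alpha_\varphi=1$. A one-parameter continuous semigroup $\{\psi_t\}_{t\ge0}$ of holomorphic self-maps of $\mathbb{D}$ is called elliptic, hyperbolic or parabolic if it consists of elliptic, hyperbolic or parabolic self-maps of $\mathbb{D}$, respectively.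
   Formalization: The parabolic case assumes p̃(0) ≠ 0: if A = B = k = 0 then every ψ_t is the identity, which is elliptic, so the claim fails there. The type of the semigroup is read from the maps ψ_t with t > 0, since ψ_0 is the identity. *)

(* Defs.v *)
(* Stdlib reals, complex numbers of Coquelicot. *)
From Stdlib Require Import Reals.
From Coquelicot Require Import Coquelicot.
Open Scope C_scope.

(* Self-maps of the disk are represented by total functions [C -> C], of which
   only the restriction to the open unit disk is ever used. *)
Definition in_disk (z : C) : Prop := (Cmod z < 1)%R.

Definition in_circle (z : C) : Prop := Cmod z = 1%R.

Definition holo_self_map (phi : C -> C) : Prop :=
  (forall z, in_disk z -> ex_derive (K := C_AbsRing) (V := C_NormedModule) phi z) /\
  (forall z, in_disk z -> in_disk (phi z)).

Definition disk_automorphism (phi : C -> C) : Prop :=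
  holo_self_map phi /\
  exists g : C -> C, holo_self_map g /\
    (forall z, in_disk z -> g (phi z) = z) /\
    (forall z, in_disk z -> phi (g z) = z).

(* Non-tangential approach region (Stolz region) of aperture [M] at [tau]. *)
Definition stolz (tau : C) (M : R) (z : C) : Prop :=
  in_disk z /\ (Cmod (z - tau) < M * (1 - Cmod z))%R.

Definition angular_lim (f : C -> C) (tau l : C) : Prop :=
  forall M : R, (1 < M)%R ->
    filterlim f (within (stolz tau M) (locally tau)) (locally l).

Definition elliptic (phi : C -> C) : Prop :=
  holo_self_map phi /\ exists tau, in_disk tau /\ phi tau = tau.

(* [tau] is a boundary Denjoy-Wolff point of [phi], and [alpha] is the angular
   limit of the derivative there. *)
Definition boundary_DW (phi : C -> C) (tau : C) (alpha : R) : Prop :=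
  in_circle tau /\ angular_lim phi tau tau /\
  angular_lim (C_derive phi) tau (RtoC alpha) /\ (0 < alpha <= 1)%R.

Definition hyperbolic (phi : C -> C) : Prop :=
  holo_self_map phi /\ ~ elliptic phi /\
  exists (tau : C) (alpha : R), boundary_DW phi tau alpha /\ (alpha < 1)%R.

Definition parabolic (phi : C -> C) : Prop :=
  holo_self_map phi /\ ~ elliptic phi /\
  exists (tau : C) (alpha : R), boundary_DW phi tau alpha /\ alpha = 1%R.

(* Only the values [psi t] for [t >= 0] matter. The last clause is continuity
   of [t |-> psi t] for uniform convergence on compact subsets of the disk. *)
Definition continuous_semigroup (psi : R -> C -> C) : Prop :=
  (forall t : R, (0 <= t)%R -> holo_self_map (psi t)) /\
  (forall z, in_disk z -> psi 0%R z = z) /\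
  (forall (s t : R) (z : C), (0 <= s)%R -> (0 <= t)%R -> in_disk z ->
     psi (s + t)%R z = psi s (psi t z)) /\
  (forall t0 r : R, (0 <= t0)%R -> (r < 1)%R -> forall eps : posreal,
     within (fun t : R => (0 <= t)%R) (locally t0)
       (fun t : R => forall z : C, (Cmod z <= r)%R ->
          (Cmod (psi t z - psi t0 z) < eps)%R)).

Definition automorphism_semigroup (psi : R -> C -> C) : Prop :=
  continuous_semigroup psi /\
  forall t : R, (0 <= t)%R -> disk_automorphism (psi t).

(* The type of a semigroup is read off the maps with [t > 0], since [psi 0] is
   always the identity, which has fixed points in the disk. *)
Definition elliptic_semigroup (psi : R -> C -> C) : Prop :=
  continuous_semigroup psi /\ forall t : R, (0 < t)%R -> elliptic (psi t).

Definition hyperbolic_semigroup (psi : R -> C -> C) : Prop :=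
  continuous_semigroup psi /\ forall t : R, (0 < t)%R -> hyperbolic (psi t).

Definition parabolic_semigroup (psi : R -> C -> C) : Prop :=
  continuous_semigroup psi /\ forall t : R, (0 < t)%R -> parabolic (psi t).

(* [u] is defined on [0, +oo) only: the derivative is two-sided at [t > 0] and
   one-sided at [t = 0]. *)
Definition is_derive_nonneg (u : R -> C) (t : R) (l : C) : Prop :=
  filterdiff (K := R_AbsRing) (U := R_NormedModule) (V := C_R_NormedModule)
    u (within (fun s : R => (0 <= s)%R) (locally t))
    (fun s : R => scal (K := R_AbsRing) (V := C_R_NormedModule) s l).

Definition ptilde (A B : R) (z : C) : C :=
  RtoC A * ((1 + z) / (1 - z)) + RtoC B * Ci.

(* Main.v *)
(* With p = A + iB and 2h = 2B + k, the vector field is the quadratic polynomial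
   p - 2ihz - conj(p) z^2, so the flow is the Moebius group
     psi_t(z) = (a z + b) / (conj(b) z + conj(a)),  a = c - ihs,  b = ps,
   where c' = delta s, s' = c, c(0) = 1, s(0) = 0 and delta = |p|^2 - h^2.
   The type is decided by the sign of delta: the zeros of the vector field lie
   on the circle if delta >= 0, and at a suitable zero tau one has
   conj(b) tau + conj(a) = exp(t sqrt delta), so psi_t'(tau) = exp(-2 t sqrt delta);
   if delta < 0 one zero lies in the disk. *)
Require Import Defs.
From Stdlib Require Import Reals Lra.
From Coquelicot Require Import Coquelicot.
Open Scope C_scope.

(** * Limits of real functions and uniqueness for a linear ODE *)

Lemma filterlim_Rplus {T : Type} {F : (T -> Prop) -> Prop} {FF : Filter F}
  (f g : T -> R) (x y : R) :
  filterlim f F (locally x) -> filterlim g F (locally y) ->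
  filterlim (fun s => f s + g s)%R F (locally (x + y)%R).
Proof.
intros hf hg.
exact (filterlim_comp_2 _ _ _ hf hg (filterlim_plus (V := R_NormedModule) x y)).
Qed.

Lemma filterlim_Rmult {T : Type} {F : (T -> Prop) -> Prop} {FF : Filter F}
  (f g : T -> R) (x y : R) :
  filterlim f F (locally x) -> filterlim g F (locally y) ->
  filterlim (fun s => f s * g s)%R F (locally (x * y)%R).
Proof.
intros hf hg.
exact (filterlim_comp_2 _ _ _ hf hg (filterlim_mult (K := R_AbsRing) x y)).
Qed.

(** With [W = u + i v] the system reads [W' = (l + i m) W], so [m] only rotates [W] and
    [(|W|^2)' = 2 l |W|^2]. Hence [|W|^2 exp(-2 K t)] is nonincreasing; it tends to 0 at [0+], so it
    vanishes. *)
Lemma linear_ode_zero (u v l m : R -> R) (K : R)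
  (hu : forall t, (0 < t)%R -> is_derive u t (l t * u t - m t * v t)%R)
  (hv : forall t, (0 < t)%R -> is_derive v t (m t * u t + l t * v t)%R)
  (hl : forall t, (0 < t)%R -> (l t <= K)%R)
  (hu0 : filterlim u (at_right 0) (locally 0%R))
  (hv0 : filterlim v (at_right 0) (locally 0%R)) (t : R) :
  (0 < t)%R -> u t = 0%R /\ v t = 0%R.
Proof.
intros ht.
pose (F := fun s : R => ((u s * u s + v s * v s) * exp (- (2 * K) * s))%R).
assert (dF : forall s, (0 < s)%R -> is_derive F s
  (2 * (l s - K) * (u s * u s + v s * v s) * exp (- (2 * K) * s))%R).
{ intros s hs; pose proof (hu s hs) as h1; pose proof (hv s hs) as h2.
  unfold F; auto_derive.
  - repeat split; eexists; eassumption.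
  - apply is_derive_unique in h1, h2.
    change (Derive (fun x => u x) s) with (Derive u s).
    change (Derive (fun x => v x) s) with (Derive v s).
    rewrite h1, h2; ring. }
(* The comparison starts at a point [s > 0], because at 0 only right limits are known; afterwards
   [s] tends to 0. *)
assert (mono : forall s, (0 < s < t)%R -> (F t <= F s)%R).
{ intros s [hs hst].
  destruct (MVT_gen F s t (fun r => 2 * (l r - K) * (u r * u r + v r * v r)
                               * exp (- (2 * K) * r))%R) as [r [hr e]].
  - intros r hr; apply dF; rewrite Rmin_left in hr; lra.
  - intros r hr; rewrite Rmin_left in hr by lra.
    apply continuity_pt_filterlim, (ex_derive_continuous F).
    eexists; apply dF; lra.
  - rewrite Rmin_left in hr by lra.
    pose proof (hl r ltac:(lra)); pose proof (exp_pos (- (2 * K) * r)).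
    assert (0 <= u r * u r + v r * v r)%R by nra.
    assert (0 <= (K - l r) * (u r * u r + v r * v r) * exp (- (2 * K) * r)
                 * (t - s))%R
      by (repeat apply Rmult_le_pos; lra).
    lra. }
assert (limF : filterlim F (at_right 0) (locally 0%R)).
{ assert (le : filterlim (fun s : R => exp (- (2 * K) * s)) (at_right 0)
                 (locally 1%R)).
  { apply (filterlim_filter_le_1 (F := locally 0%R)).
    - apply filter_le_within.
    - replace 1%R with (exp (- (2 * K) * 0)) by (rewrite Rmult_0_r; apply exp_0).
      apply (ex_derive_continuous (fun s : R => exp (- (2 * K) * s))).
      auto_derive; trivial. }
  replace 0%R with ((0 * 0 + 0 * 0) * 1)%R at 2 by ring.
  apply filterlim_Rmult; [|exact le].
  apply filterlim_Rplus; apply filterlim_Rmult; trivial. }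
assert (hF : (F t <= 0)%R).
{ apply (filterlim_le (F := at_right 0) (fun _ => F t) F (F t) 0%R).
  - exists (mkposreal t ht); intros s hs hs0; apply mono; split; trivial.
    apply Rabs_lt_between' in hs; simpl in hs; lra.
  - apply filterlim_const.
  - exact limF. }
unfold F in hF; pose proof (exp_pos (- (2 * K) * t)).
assert (u t * u t + v t * v t <= 0)%R by nra.
split; nra.
Qed.

(** * Complex-valued functions through their real and imaginary parts *)

(** Near a point [t > 0] the constraint [0 <= s] holds automatically, so the restricted derivative
    is an ordinary one, and the linear maps [fst] and [snd] may be applied to it. *)
Lemma is_derive_nonneg_pos (u : R -> C) (t : R) (l : C) :
  (0 < t)%R -> is_derive_nonneg u t l ->
  is_derive (fun s => fst (u s)) t (fst l) /\
  is_derive (fun s => snd (u s)) t (snd l).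
Proof.
intros ht hu.
assert (d : is_derive (K := R_AbsRing) (V := C_R_NormedModule) u t l).
{ destruct hu as [lin dom]; split; [exact lin|].
  intros x hx eps.
  assert (e : x = t) by (symmetry; apply (is_filter_lim_locally_unique t x hx)).
  subst x.
  generalize (dom t (fun P H => filter_le_within _ P H) eps); unfold within.
  assert (hpos : locally t (fun s : R => (0 <= s)%R)).
  { exists (mkposreal t ht); intros s hs.
    apply Rabs_lt_between' in hs; simpl in hs; lra. }
  intros h; generalize (filter_and _ _ h hpos); apply filter_imp.
  intros s [h1 h2]; auto. }
split.
- exact (filterdiff_comp u fst _ fst d (filterdiff_linear fst is_linear_fst)).
- exact (filterdiff_comp u snd _ snd d (filterdiff_linear snd is_linear_snd)).
Qed.

Lemma continuous_C_components (U : UniformSpace) (f : U -> C) (x : U) :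
  continuous (fun u => fst (f u)) x -> continuous (fun u => snd (f u)) x ->
  continuous f x.
Proof.
intros h1 h2; apply filterlim_locally; intros eps.
generalize (filter_and _ _ (proj1 (filterlim_locally _ _) h1 eps)
                           (proj1 (filterlim_locally _ _) h2 eps)).
apply filter_imp; intros y hy; exact hy.
Qed.

Lemma continuous_C_re (U : UniformSpace) (f : U -> C) (x : U) :
  continuous f x -> continuous (fun u => fst (f u)) x.
Proof.
intros h; apply (continuous_comp f fst); [exact h|].
destruct (f x); apply continuous_fst.
Qed.

Lemma continuous_C_im (U : UniformSpace) (f : U -> C) (x : U) :
  continuous f x -> continuous (fun u => snd (f u)) x.
Proof.
intros h; apply (continuous_comp f snd); [exact h|].
destruct (f x); apply continuous_snd.
Qed.

Lemma continuous_Cplus (U : UniformSpace) (f g : U -> C) (x : U) :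
  continuous f x -> continuous g x -> continuous (fun u => f u + g u) x.
Proof.
intros hf hg; apply continuous_C_components; simpl.
- apply (continuous_plus (fun u => fst (f u)) (fun u => fst (g u)));
    apply continuous_C_re; trivial.
- apply (continuous_plus (fun u => snd (f u)) (fun u => snd (g u)));
    apply continuous_C_im; trivial.
Qed.

Lemma continuous_Cmult (U : UniformSpace) (f g : U -> C) (x : U) :
  continuous f x -> continuous g x -> continuous (fun u => f u * g u) x.
Proof.
intros hf hg.
pose proof (continuous_C_re _ f x hf); pose proof (continuous_C_im _ f x hf).
pose proof (continuous_C_re _ g x hg); pose proof (continuous_C_im _ g x hg).
apply continuous_C_components; simpl.
- apply (continuous_minus (fun u => (fst (f u) * fst (g u))%R)
                          (fun u => (snd (f u) * snd (g u))%R));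
  apply @continuous_mult; trivial.
- apply (continuous_plus (fun u => (fst (f u) * snd (g u))%R)
                         (fun u => (snd (f u) * fst (g u))%R));
  apply @continuous_mult; trivial.
Qed.

Lemma continuous_Cinv (U : UniformSpace) (f : U -> C) (x : U) :
  continuous f x -> f x <> 0 -> continuous (fun u => / f u) x.
Proof.
intros hf h0.
pose proof (continuous_C_re _ f x hf); pose proof (continuous_C_im _ f x hf).
assert (n0 : (fst (f x) ^ 2 + snd (f x) ^ 2 <> 0)%R).
{ intros e; apply h0; apply injective_projections; simpl; nra. }
assert (hn : continuous (fun u => / (fst (f u) ^ 2 + snd (f u) ^ 2))%R x).
{ apply (continuous_comp (fun u => (fst (f u) ^ 2 + snd (f u) ^ 2)%R) Rinv).
  - simpl; apply @continuous_plus; repeat apply @continuous_mult;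
      trivial; apply continuous_const.
  - apply continuity_pt_filterlim; apply continuity_pt_inv; trivial.
    apply derivable_continuous_pt, derivable_pt_id. }
apply continuous_C_components; simpl; unfold Rdiv.
- apply @continuous_mult; trivial.
- apply @continuous_mult; trivial.
  apply (continuous_opp (fun u => snd (f u))); trivial.
Qed.

(** * Moebius automorphisms of the disk and their boundary fixed points *)

Lemma in_disk_sqr (z : C) :
  in_disk z <-> (fst z * fst z + snd z * snd z < 1)%R.
Proof.
unfold in_disk, Cmod; replace (fst z ^ 2 + snd z ^ 2)%R
  with (fst z * fst z + snd z * snd z)%R by ring.
rewrite <- sqrt_1 at 1; split; intros h.
- apply sqrt_lt_0_alt; exact h.
- apply sqrt_lt_1_alt; nra.
Qed.

Lemma in_circle_sqr (z : C) :
  (fst z * fst z + snd z * snd z = 1)%R -> in_circle z.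
Proof.
intros h; unfold in_circle, Cmod.
replace (fst z ^ 2 + snd z ^ 2)%R with 1%R by lra; apply sqrt_1.
Qed.

Lemma locally_in_disk (z : C) : in_disk z -> locally z in_disk.
Proof.
intros hz.
assert (c : continuous (fun w : C => (fst w * fst w + snd w * snd w)%R) z).
{ pose proof (continuous_C_re _ (fun w : C => w) z (continuous_id z)).
  pose proof (continuous_C_im _ (fun w : C => w) z (continuous_id z)).
  apply @continuous_plus; apply @continuous_mult; trivial. }
generalize (c _ (open_lt 1%R _ (proj1 (in_disk_sqr z) hz))); unfold filtermap.
apply filter_imp; intros w; apply in_disk_sqr.
Qed.

(** If the denominator vanished, so would the numerator [a z + b]. But [a] times the denominator
    minus [conj b] times the numerator is the determinant, which is 1. *)
Lemma automorphism_denom_neq0 (a b z w : C) :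
  a * Cconj a - b * Cconj b = 1 ->
  w * (Cconj b * z + Cconj a) = a * z + b -> Cconj b * z + Cconj a <> 0.
Proof.
intros hab e h0; rewrite h0, Cmult_0_r in e.
apply C1_nz; rewrite <- hab.
replace (a * Cconj a - b * Cconj b)
  with (a * (Cconj b * z + Cconj a) - Cconj b * (a * z + b)) by ring.
rewrite h0, <- e; ring.
Qed.

Lemma continuous_affine (a b z : C) : continuous (fun y : C => a * y + b) z.
Proof.
apply continuous_Cplus; [apply continuous_Cmult|];
  first [apply continuous_const | apply continuous_id].
Qed.

(** For determinant 1 the difference quotient between [y] and [z] is exactly the inverse of the
    product of the denominators at [y] and [z]; then [y] tends to [z]. *)
Lemma automorphism_C_derive (f : C -> C) (a b z : C) :
  a * Cconj a - b * Cconj b = 1 ->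
  (forall y, in_disk y -> f y * (Cconj b * y + Cconj a) = a * y + b) ->
  in_disk z ->
  C_derive f z = / ((Cconj b * z + Cconj a) * (Cconj b * z + Cconj a)).
Proof.
intros hab hf hz; apply is_C_lim_unique.
pose proof (automorphism_denom_neq0 a b z (f z) hab (hf z hz)) as nz.
apply (filterlim_ext_loc
  (fun y => / ((Cconj b * y + Cconj a) * (Cconj b * z + Cconj a)))).
- unfold locally', within; generalize (locally_in_disk z hz).
  apply filter_imp; intros y hy yz; change C in (type of y).
  pose proof (automorphism_denom_neq0 a b y (f y) hab (hf y hy)) as ny.
  assert (y - z <> 0) by (apply Cminus_eq_contra, yz).
  assert (ey : f y = (a * y + b) / (Cconj b * y + Cconj a))
    by (rewrite <- (hf y hy); field; trivial).
  assert (ez : f z = (a * z + b) / (Cconj b * z + Cconj a))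
    by (rewrite <- (hf z hz); field; trivial).
  rewrite ey, ez.
  replace (/ ((Cconj b * y + Cconj a) * (Cconj b * z + Cconj a)))
    with ((a * Cconj a - b * Cconj b) /
          ((Cconj b * y + Cconj a) * (Cconj b * z + Cconj a)))
    by (rewrite hab; field; auto).
  field; auto.
- apply (filterlim_filter_le_1 (F := locally z)); [apply filter_le_within|].
  apply (continuous_Cinv _ (fun y => (Cconj b * y + Cconj a) * (Cconj b * z + Cconj a))).
  + apply continuous_Cmult; [apply continuous_affine | apply continuous_const].
  + apply Cmult_neq_0; trivial.
Qed.

Lemma angular_lim_continuous (g h : C -> C) (tau : C) :
  (forall z, in_disk z -> g z = h z) -> continuous h tau ->
  angular_lim g tau (h tau).
Proof.
intros e c M _.
apply (filterlim_within_ext _ h).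
- intros z [hz _]; symmetry; auto.
- apply (filterlim_filter_le_1 (F := locally tau)); [apply filter_le_within|].
  exact c.
Qed.

(** The last two equations say that [(tau, 1)] is an eigenvector of the matrix of [f] with real
    eigenvalue [d]. So the Moebius formula fixes [tau] with derivative [1 / d^2], and both it and
    its derivative are continuous at [tau]. *)
Lemma automorphism_boundary_DW (f : C -> C) (a b tau : C) (d : R) :
  a * Cconj a - b * Cconj b = 1 ->
  (forall z, in_disk z -> f z * (Cconj b * z + Cconj a) = a * z + b) ->
  in_circle tau -> (1 <= d)%R -> Cconj b * tau + Cconj a = RtoC d ->
  a * tau + b = tau * RtoC d -> boundary_DW f tau (/ (d * d)).
Proof.
intros hab hf ht hd hden hnum.
assert (d0 : RtoC d <> 0) by (intros e; apply RtoC_inj in e; lra).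
split; [exact ht | split; [|split]].
- pose (h := fun y => (a * y + b) * / (Cconj b * y + Cconj a)).
  replace tau with (h tau) at 2
    by (unfold h; rewrite hden, hnum; field; trivial).
  apply angular_lim_continuous; unfold h.
  + intros z hz; rewrite <- (hf z hz); field.
    exact (automorphism_denom_neq0 a b z (f z) hab (hf z hz)).
  + apply continuous_Cmult.
    * apply continuous_affine.
    * apply continuous_Cinv; [apply continuous_affine | rewrite hden; trivial].
- pose (h := fun y => / ((Cconj b * y + Cconj a) * (Cconj b * y + Cconj a))).
  replace (RtoC (/ (d * d))) with (h tau)
    by (unfold h; rewrite hden, RtoC_inv, RtoC_mult; trivial; nra).
  apply angular_lim_continuous; unfold h.
  + intros z hz; apply automorphism_C_derive; trivial.
  + apply continuous_Cinv; [apply continuous_Cmult; apply continuous_affine|].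
    rewrite hden; apply Cmult_neq_0; trivial.
- split; [apply Rinv_0_lt_compat; nra|].
  rewrite <- Rinv_1; apply Rinv_le_contravar; nra.
Qed.

(** * The generator as a quadratic polynomial *)

(* [x + i y] is a zero of the generator [p - 2 i h z - conj(p) z^2], [p = A + i B]. *)
Lemma generator_zero_not_in_disk (A B h x y : R) :
  (0 < A * A + B * B)%R -> (h * h <= A * A + B * B)%R ->
  (x * x + y * y < 1)%R ->
  (A * (x * x - y * y) + 2 * B * x * y - 2 * h * y - A = 0)%R ->
  (2 * A * x * y - B * (x * x - y * y) + 2 * h * x - B = 0)%R -> False.
Proof.
intros hP hh hn e1 e2.
set (n := (x * x + y * y)%R) in *.
assert (n0 : (0 <= n)%R) by (unfold n; nra).
(* Multiply the equation by the conjugate of [x + i y]. *)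
assert (X0 : ((A * x + B * y) * (n - 1) = 0)%R).
{ replace ((A * x + B * y) * (n - 1))%R
    with ((A * (x * x - y * y) + 2 * B * x * y - 2 * h * y - A) * x
        + (2 * A * x * y - B * (x * x - y * y) + 2 * h * x - B) * y)%R
    by (unfold n; ring).
  rewrite e1, e2; ring. }
assert (Y0 : ((B * x - A * y) * (1 + n) = 2 * h * n)%R).
{ apply Rminus_diag_uniq.
  replace ((B * x - A * y) * (1 + n) - 2 * h * n)%R
    with ((A * (x * x - y * y) + 2 * B * x * y - 2 * h * y - A) * y
        - (2 * A * x * y - B * (x * x - y * y) + 2 * h * x - B) * x)%R
    by (unfold n; ring).
  rewrite e1, e2; ring. }
apply Rmult_integral in X0; destruct X0 as [X0|X0]; [|lra].
(* Here [A x + B y] and [B x - A y] are, up to sign, the real and imaginary parts of [conj(p) z], so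
   their squares add up to [|p|^2 n]. The first one is now 0. *)
assert (Q : ((A * A + B * B) * n * ((1 + n) * (1 + n))
             = 4 * (h * h) * (n * n))%R).
{ replace (4 * (h * h) * (n * n))%R with ((2 * h * n) * (2 * h * n))%R by ring.
  rewrite <- Y0.
  replace ((A * A + B * B) * n)%R
    with ((A * x + B * y) * (A * x + B * y) + (B * x - A * y) * (B * x - A * y))%R
    by (unfold n; ring).
  rewrite X0; ring. }
assert (Q2 : (h * h * (n * n) <= (A * A + B * B) * (n * n))%R)
  by (apply Rmult_le_compat_r; nra).
(* From [h^2 <= |p|^2] and [(1 + n)^2 - 4 n = (1 - n)^2]. As [n < 1], this forces [z = 0], where the
   generator takes the value [p], which is nonzero. *)
assert (Q3 : ((A * A + B * B) * n * ((1 - n) * (1 - n)) <= 0)%R) by nra.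
assert (n1 : n = 0%R).
{ destruct (Rle_lt_or_eq_dec 0 n n0) as [p|]; [exfalso|auto].
  assert (0 < (A * A + B * B) * n * ((1 - n) * (1 - n)))%R
    by (repeat apply Rmult_lt_0_compat; lra).
  lra. }
assert (x = 0%R) by (unfold n in n1; nra).
assert (y = 0%R) by (unfold n in n1; nra).
subst x y; nra.
Qed.

(** The double zero at 1 cancels the pole of [ptilde]: [(w - 1)^2 (1 + w) / (1 - w) = 1 - w^2]. *)
Lemma generator_quadratic (A B k : R) (w : C) : in_disk w ->
  (w - 1) ^ 2 * ptilde A B w - Ci * RtoC k * w
  = (A, B) - Ci * RtoC (2 * B + k) * w - Cconj (A, B) * w ^ 2.
Proof.
intros hw.
assert (n : 1 - w <> 0).
{ apply Cminus_eq_contra; intros e; rewrite <- e in hw.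
  unfold in_disk in hw; rewrite Cmod_1 in hw; lra. }
replace ((w - 1) ^ 2 * ptilde A B w - Ci * RtoC k * w)
  with (RtoC A * (1 - w ^ 2) + RtoC B * Ci * (1 - w) ^ 2 - Ci * RtoC k * w)
  by (unfold ptilde; field; trivial).
apply injective_projections; simpl; ring.
Qed.

(** * Explicit form of the flow *)

(** Supplies the initial condition, as a right limit, for the uniqueness argument on [t > 0]. The
    compact set used is the closed disk of radius [|z|]. *)
Lemma semigroup_right_continuous (psi : R -> C -> C) (z : C) :
  continuous_semigroup psi -> in_disk z ->
  filterlim (fun s => fst (psi s z)) (at_right 0) (locally (fst z)) /\
  filterlim (fun s => snd (psi s z)) (at_right 0) (locally (snd z)).
Proof.
intros [_ [h0 [_ hc]]] hz.
assert (close : forall eps : posreal,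
  at_right 0 (fun s => (Cmod (psi s z - z) < eps)%R)).
{ intros eps.
  generalize (hc 0%R (Cmod z) (Rle_refl 0) hz eps); unfold at_right, within.
  apply filter_imp; intros s hs hs0.
  rewrite <- (h0 z hz) at 2; apply hs; lra. }
split; apply filterlim_locally; intros eps; generalize (close eps);
  apply filter_imp; intros s hs.
- apply Rle_lt_trans with (2 := hs).
  exact (Rle_trans _ _ _ (Rmax_l _ _) (Rmax_Cmod (psi s z - z))).
- apply Rle_lt_trans with (2 := hs).
  exact (Rle_trans _ _ _ (Rmax_r _ _) (Rmax_Cmod (psi s z - z))).
Qed.

(* The flow is the Moebius action of the exponential of [t] times the matrix
   [(-ih, p; conj p, ih)], whose square is [delta] times the identity. *)
Lemma flow_formula (A B k h delta : R) (c s : R -> R) (psi : R -> C -> C)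
  (hpsi : continuous_semigroup psi)
  (hode : forall (t : R) (z : C), (0 <= t)%R -> in_disk z ->
     is_derive_nonneg (fun s : R => psi s z) t
       ((psi t z - 1) ^ 2 * ptilde A B (psi t z)
          - Ci * RtoC k * psi t z))
  (hh : (2 * h = 2 * B + k)%R) (hdelta : (delta = A * A + B * B - h * h)%R)
  (dc : forall t, is_derive c t (delta * s t)%R)
  (ds : forall t, is_derive s t (c t))
  (c0 : c 0%R = 1%R) (s0 : s 0%R = 0%R) (t : R) (z : C) :
  (0 < t)%R -> in_disk z ->
  psi t z * (Cconj ((A * s t)%R, (B * s t)%R) * z
             + Cconj (c t, (- h * s t)%R))
  = (c t, (- h * s t)%R) * z + ((A * s t)%R, (B * s t)%R).
Proof.
intros ht hz.
(* Real and imaginary parts of the orbit [w], of the denominator [D = conj(b) z + conj(a)] and of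
   the numerator [N = a z + b]. *)
pose (w1 := fun r => fst (psi r z)); pose (w2 := fun r => snd (psi r z)).
pose (D1 := fun r => ((A * fst z + B * snd z) * s r + c r)%R).
pose (D2 := fun r => ((A * snd z - B * fst z + h) * s r)%R).
pose (N1 := fun r => (fst z * c r + (h * snd z + A) * s r)%R).
pose (N2 := fun r => (snd z * c r + (B - h * fst z) * s r)%R).
assert (hw : forall r, (0 < r)%R ->
  is_derive w1 r (A + 2 * h * w2 r - A * (w1 r * w1 r - w2 r * w2 r)
                  - 2 * B * w1 r * w2 r)%R /\
  is_derive w2 r (B - 2 * h * w1 r - 2 * A * w1 r * w2 r
                  + B * (w1 r * w1 r - w2 r * w2 r))%R).
{ intros r hr.
  destruct (is_derive_nonneg_pos _ _ _ hr (hode r z (Rlt_le _ _ hr) hz)) as [h1 h2].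
  rewrite generator_quadratic in h1, h2
    by (apply (proj1 hpsi); [lra | exact hz]).
  split.
  - eapply is_derive_ext; [intros x; reflexivity|].
    evar_last; [exact h1|]; rewrite <- hh; unfold w1, w2; simpl; ring.
  - eapply is_derive_ext; [intros x; reflexivity|].
    evar_last; [exact h2|]; rewrite <- hh; unfold w1, w2; simpl; ring. }
assert (lim : forall f l, is_derive (K := R_AbsRing) (V := R_NormedModule) f 0%R l ->
          filterlim f (at_right 0) (locally (f 0%R))).
{ intros f l hf; apply (filterlim_filter_le_1 (F := locally 0%R));
    [apply filter_le_within|].
  apply (ex_derive_continuous f); exists l; exact hf. }
destruct (semigroup_right_continuous psi z hpsi hz) as [lw1 lw2].
pose proof (lim c _ (dc 0%R)) as lc; pose proof (lim s _ (ds 0%R)) as ls.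
rewrite c0 in lc; rewrite s0 in ls.
(* The defect [E = w D - N] solves a linear equation: [N' = -i h N + p D], [D' = conj(p) N + i h D]
   and the quadratic equation for [w] give [E' = -(conj(p) w + i h) E]. Since [|w| < 1], the real
   part of the coefficient is at most [|A| + |B|]. *)
destruct (linear_ode_zero
  (fun r => w1 r * D1 r + (- 1) * (w2 r * D2 r) + (- 1) * N1 r)%R
  (fun r => w1 r * D2 r + w2 r * D1 r + (- 1) * N2 r)%R
  (fun r => - (A * w1 r + B * w2 r))%R
  (fun r => - (h + A * w2 r - B * w1 r))%R (Rabs A + Rabs B)%R) with (t := t)
  as [e1 e2]; trivial.
1, 2: (intros r hr; destruct (hw r hr) as [h1 h2];
  pose proof (dc r) as h3; pose proof (ds r) as h4;
  unfold D1, D2, N1, N2; auto_derive;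
  [repeat split; eexists; eassumption|];
  apply is_derive_unique in h1, h2, h3, h4;
  change (Derive (fun x => w1 x) r) with (Derive w1 r);
  change (Derive (fun x => w2 x) r) with (Derive w2 r);
  change (Derive (fun x => c x) r) with (Derive c r);
  change (Derive (fun x => s x) r) with (Derive s r);
  rewrite h1, h2, h3, h4, hdelta; ring).
- intros r hr.
  assert (hd : in_disk (psi r z)) by (apply (proj1 hpsi); [lra | exact hz]).
  apply in_disk_sqr in hd; fold (w1 r) (w2 r) in hd.
  assert (-1 <= w1 r <= 1)%R by nra; assert (-1 <= w2 r <= 1)%R by nra.
  assert (x1 : (- (A * w1 r) <= Rabs A)%R) by (unfold Rabs; destruct (Rcase_abs A); nra).
  assert (x2 : (- (B * w2 r) <= Rabs B)%R) by (unfold Rabs; destruct (Rcase_abs B); nra).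
  lra.
(* At [0+] one has [w -> z], [D -> 1] and [N -> z], so [E] tends to 0; the limit is written out term
   by term. *)
- replace 0%R with (fst z * ((A * fst z + B * snd z) * 0 + 1)
    + (-1) * (snd z * ((A * snd z - B * fst z + h) * 0))
    + (-1) * (fst z * 1 + (h * snd z + A) * 0))%R at 2 by ring.
  unfold D1, D2, N1, w1, w2.
  repeat first [apply filterlim_Rplus | apply filterlim_Rmult];
    trivial; apply filterlim_const.
- replace 0%R with (fst z * ((A * snd z - B * fst z + h) * 0)
    + snd z * ((A * fst z + B * snd z) * 0 + 1)
    + (-1) * (snd z * 1 + (B - h * fst z) * 0))%R at 2 by ring.
  unfold D1, D2, N2, w1, w2.
  repeat first [apply filterlim_Rplus | apply filterlim_Rmult];
    trivial; apply filterlim_const.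
- unfold w1, w2, D1, D2, N1, N2 in e1, e2.
  apply injective_projections; simpl; lra.
Qed.

(** * Coefficients of the flow and its fixed points *)

(** The functions are [cosh(mu t)] and [sinh(mu t) / mu], degenerating to [1] and [t] when [mu = 0].
    The quadratic identity is the determinant condition for the flow, and the exponential is its
    eigenvalue at the boundary fixed point. *)
Lemma hyperbolic_coefficients (mu : R) : (0 <= mu)%R -> exists c s : R -> R,
  (forall t, is_derive c t (mu * mu * s t)%R) /\
  (forall t, is_derive s t (c t)) /\ c 0%R = 1%R /\ s 0%R = 0%R /\
  (forall t, (0 < t)%R -> (0 < s t)%R) /\
  (forall t, (c t * c t - mu * mu * (s t * s t) = 1)%R) /\
  (forall t, (c t + mu * s t = exp (mu * t))%R).
Proof.
intros hmu; destruct (Rle_lt_or_eq_dec 0 mu hmu) as [h|<-].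
- exists (fun t => (exp (mu * t) + exp (- (mu * t))) / 2)%R,
         (fun t => (exp (mu * t) - exp (- (mu * t))) / (2 * mu))%R.
  assert (inv : forall t, (exp (mu * t) * exp (- (mu * t)) = 1)%R)
    by (intros t; rewrite <- exp_plus, Rplus_opp_r; apply exp_0).
  refine (conj _ (conj _ (conj _ (conj _ (conj _ (conj _ _)))))).
  + intros t; auto_derive; trivial; field; lra.
  + intros t; auto_derive; [lra|field; lra].
  + rewrite Rmult_0_r, Ropp_0, exp_0; field.
  + rewrite Rmult_0_r, Ropp_0, exp_0; field; lra.
  + intros t ht; apply Rdiv_lt_0_compat; [|lra].
    assert (exp (- (mu * t)) < exp (mu * t))%R by (apply exp_increasing; nra).
    lra.
  + intros t; transitivity (exp (mu * t) * exp (- (mu * t)))%R;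
      [field; lra | apply inv].
  + intros t; field; lra.
- exists (fun _ => 1%R), (fun t => t).
  refine (conj _ (conj _ (conj _ (conj _ (conj _ (conj _ _)))))).
  + intros t; auto_derive; trivial; ring.
  + intros t; auto_derive; trivial; ring.
  + trivial.
  + trivial.
  + trivial.
  + intros t; ring.
  + intros t; rewrite Rmult_0_l, exp_0; ring.
Qed.

Lemma elliptic_coefficients (omega : R) : (0 < omega)%R -> exists c s : R -> R,
  (forall t, is_derive c t (- (omega * omega) * s t)%R) /\
  (forall t, is_derive s t (c t)) /\ c 0%R = 1%R /\ s 0%R = 0%R /\
  (forall t, (c t * c t + omega * omega * (s t * s t) = 1)%R).
Proof.
intros h; exists (fun t => cos (omega * t)), (fun t => sin (omega * t) / omega)%R.
refine (conj _ (conj _ (conj _ (conj _ _)))).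
- intros t; auto_derive; trivial; field; lra.
- intros t; auto_derive; trivial; field; lra.
- rewrite Rmult_0_r; apply cos_0.
- rewrite Rmult_0_r, sin_0; field; lra.
- intros t; rewrite <- (sin2_cos2 (omega * t)); unfold Rsqr; field; lra.
Qed.

(** Treats the hyperbolic case ([mu > 0]) and the parabolic case ([mu = 0]) together. *)
Lemma boundary_fixed_point_type (A B k h mu : R) (psi : R -> C -> C)
  (hpsi : continuous_semigroup psi)
  (hode : forall (t : R) (z : C), (0 <= t)%R -> in_disk z ->
     is_derive_nonneg (fun s : R => psi s z) t
       ((psi t z - 1) ^ 2 * ptilde A B (psi t z)
          - Ci * RtoC k * psi t z))
  (hh : (2 * h = 2 * B + k)%R) (hP : (0 < A * A + B * B)%R) (hmu : (0 <= mu)%R)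
  (hd : (mu * mu = A * A + B * B - h * h)%R) (t : R) : (0 < t)%R ->
  ~ elliptic (psi t) /\
  exists tau, boundary_DW (psi t) tau (/ (exp (mu * t) * exp (mu * t))).
Proof.
intros ht.
destruct (hyperbolic_coefficients mu hmu)
  as [c [s [dc [ds [c0 [s0 [spos [det hexp]]]]]]]].
pose proof (fun z => flow_formula A B k h (mu * mu) c s psi hpsi hode hh hd
              dc ds c0 s0 t z ht) as flow.
pose proof (spos t ht) as st.
split.
- intros [_ [[x y] [hz e]]].
  pose proof (flow _ hz) as f; rewrite e in f.
  apply (f_equal fst) in f as f1; apply (f_equal snd) in f as f2.
  simpl in f1, f2; apply in_disk_sqr in hz; simpl in hz.
  (* The fixed point equation of [psi t] is the equation for zeros of the generator multiplied by
     [s t], which is positive. *)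
  apply (generator_zero_not_in_disk A B h x y); trivial; [nra| |];
    apply (Rmult_eq_reg_l (s t)); lra.
(* This is [tau = (mu - i h) p / |p|^2]. It satisfies [conj(p) tau = mu - i h], so the denominator
   at [tau] is [c + mu s = exp(mu t)], and [|tau| = 1] because [mu^2 + h^2 = |p|^2]. *)
- exists ((mu * A + h * B) / (A * A + B * B),
          (mu * B - h * A) / (A * A + B * B))%R.
  apply (automorphism_boundary_DW _ (c t, (- h * s t)%R) ((A * s t)%R, (B * s t)%R)).
  + pose proof (det t).
    apply injective_projections; simpl; nra.
  + exact flow.
  + apply in_circle_sqr; simpl.
    transitivity ((mu * mu + h * h) / (A * A + B * B))%R;
      [field | rewrite hd; field]; lra.
  + rewrite <- exp_0; destruct (Rle_lt_or_eq_dec 0 mu hmu) as [h0|<-].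
    * left; apply exp_increasing; nra.
    * rewrite Rmult_0_l; right; trivial.
  + rewrite <- hexp; apply injective_projections; simpl; field; lra.
  + rewrite <- hexp; apply injective_projections; simpl.
    * apply Rminus_diag_uniq.
      transitivity (s t * A * (A * A + B * B - h * h - mu * mu) / (A * A + B * B))%R;
        [field | rewrite hd; field]; lra.
    * apply Rminus_diag_uniq.
      transitivity (s t * B * (A * A + B * B - h * h - mu * mu) / (A * A + B * B))%R;
        [field | rewrite hd; field]; lra.
Qed.

Lemma interior_fixed_point (A B k h : R) (psi : R -> C -> C)
  (hpsi : continuous_semigroup psi)
  (hode : forall (t : R) (z : C), (0 <= t)%R -> in_disk z ->
     is_derive_nonneg (fun s : R => psi s z) t
       ((psi t z - 1) ^ 2 * ptilde A B (psi t z)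
          - Ci * RtoC k * psi t z))
  (hh : (2 * h = 2 * B + k)%R) (hd : (A * A + B * B < h * h)%R) (t : R) :
  (0 < t)%R -> elliptic (psi t).
Proof.
intros ht; split; [apply (proj1 hpsi); lra|].
set (om := sqrt (h * h - (A * A + B * B))).
assert (om0 : (0 < om)%R) by (apply sqrt_lt_R0; lra).
assert (om2 : (om * om = h * h - (A * A + B * B))%R) by (apply sqrt_sqrt; lra).
destruct (elliptic_coefficients om om0) as [c [s [dc [ds [c0 [s0 det]]]]]].
assert (hd' : (- (om * om) = A * A + B * B - h * h)%R) by lra.
pose proof (fun z => flow_formula A B k h _ c s psi hpsi hode hh hd'
              dc ds c0 s0 t z ht) as flow.
(* The zeros of the generator are [- i p / x], with [x] a root of this quadratic. *)
assert (hk : exists x, (x * x - 2 * h * x + (A * A + B * B) = 0)%R /\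
               (A * A + B * B < x * x)%R).
(* The sign selects the root of larger modulus. The product of the roots is [|p|^2], so this root
   has [x^2 > |p|^2], which puts [-i p / x] in the disk; it is nonzero even when [p = 0]. *)
{ destruct (Rle_lt_dec 0 h).
  - exists (h + om)%R; assert (0 <= h * om)%R by nra; split; nra.
  - exists (h - om)%R; assert (0 <= - h * om)%R by nra; split; nra. }
destruct hk as [x [e1 e2]].
assert (x0 : x <> 0%R) by nra.
set (tau := ((B / x)%R, (- A / x)%R)).
assert (htau : in_disk tau).
{ apply in_disk_sqr; simpl.
  replace (B / x * (B / x) + - A / x * (- A / x))%R
    with ((A * A + B * B) / (x * x))%R by (field; trivial).
  apply (proj1 (Rdiv_lt_1 (A * A + B * B) (x * x) ltac:(nra)) e2). }
exists tau; split; [exact htau|].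
pose proof (flow tau htau) as f.
assert (nz := automorphism_denom_neq0 (c t, (- h * s t)%R) ((A * s t)%R, (B * s t)%R)
                tau (psi t tau)).
set (den := Cconj ((A * s t)%R, (B * s t)%R) * tau + Cconj (c t, (- h * s t)%R)) in *.
assert (n0 : den <> 0).
{ apply nz; [|exact f]; pose proof (det t).
  apply injective_projections; simpl; nra. }
(* Both components of the difference are multiples of the quadratic in [x]. With [den] nonzero,
   [psi t tau = tau] follows by division. *)
assert (g : tau * den = (c t, (- h * s t)%R) * tau + ((A * s t)%R, (B * s t)%R)).
{ unfold den, tau; apply injective_projections; simpl; apply Rminus_diag_uniq.
  - transitivity (- s t * A * (x * x - 2 * h * x + (A * A + B * B)) / (x * x))%R;
      [field | rewrite e1; field]; trivial.
  - transitivity (- s t * B * (x * x - 2 * h * x + (A * A + B * B)) / (x * x))%R;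
      [field | rewrite e1; field]; trivial. }
rewrite <- g in f.
replace (psi t tau) with (psi t tau * den / den) by (field; trivial).
rewrite f; field; trivial.
Qed.

(** * The type of the semigroup in terms of [k] *)

(* The condition [p0 <> 0] in the parabolic case only excludes A = B = k = 0,
   where every [psi t] is the identity, hence elliptic. *)
Theorem mainTheorem3 (A B k : R) (hA : (0 <= A)%R) (psi : R -> C -> C)
  (hpsi : automorphism_semigroup psi)
  (hinit : forall z : C, in_disk z -> psi 0%R z = z)
  (hode : forall (t : R) (z : C), (0 <= t)%R -> in_disk z ->
     is_derive_nonneg (fun s : R => psi s z) t
       ((psi t z - 1) ^ 2 * ptilde A B (psi t z)
          - Ci * RtoC k * psi t z)) :
  let p0 := ptilde A B 0 in
  ((2 * (- Im p0 - Cmod p0) < k < 2 * (- Im p0 + Cmod p0))%R ->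
     hyperbolic_semigroup psi) /\
  (p0 <> 0 ->
     (k = 2 * (- Im p0 + Cmod p0))%R \/ (k = 2 * (- Im p0 - Cmod p0))%R ->
     parabolic_semigroup psi) /\
  ((k < 2 * (- Im p0 - Cmod p0))%R \/ (k > 2 * (- Im p0 + Cmod p0))%R ->
     elliptic_semigroup psi).
Proof.
intros p0.
assert (ep : p0 = (A, B)).
{ unfold p0, ptilde; transitivity (RtoC A + RtoC B * Ci).
  - field; intros e; apply (f_equal fst) in e; simpl in e; lra.
  - apply injective_projections; simpl; ring. }
rewrite ep; change (Im (A, B)) with B.
set (r := Cmod (A, B)).
assert (r0 : (0 <= r)%R) by apply Cmod_ge_0.
assert (r2 : (r * r = A * A + B * B)%R).
{ unfold r, Cmod; rewrite sqrt_sqrt; simpl; nra. }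
destruct hpsi as [hs _].
(* In terms of [h] the three ranges of [k] become [|h| < r], [|h| = r] and [|h| > r], with
   [r = |p|]. *)
pose (h := (B + k / 2)%R).
assert (hh : (2 * h = 2 * B + k)%R) by (unfold h; field).
split; [|split].
- intros [k1 k2]; split; [exact hs|]; intros t ht.
  assert (hr : (- r < h < r)%R) by lra.
  pose (mu := sqrt (A * A + B * B - h * h)).
  assert (mu0 : (0 < mu)%R) by (apply sqrt_lt_R0; nra).
  assert (mu2 : (mu * mu = A * A + B * B - h * h)%R) by (apply sqrt_sqrt; nra).
  destruct (boundary_fixed_point_type A B k h mu psi hs hode hh
              ltac:(nra) ltac:(lra) mu2 t ht) as [ne [tau htau]].
  split; [apply (proj1 hs); lra | split; [exact ne|]].
  exists tau; eexists; split; [exact htau|].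
  assert (1 < exp (mu * t))%R by (rewrite <- exp_0; apply exp_increasing; nra).
  rewrite <- Rinv_1; apply Rinv_lt_contravar; nra.
- intros np hk; split; [exact hs|]; intros t ht.
  (* When [|h| = r], nothing but [p0 <> 0] gives [r > 0]; in the hyperbolic case it follows from
     [-r < h < r]. *)
  assert (rp : (0 < r)%R) by (apply Cmod_gt_0; exact np).
  destruct (boundary_fixed_point_type A B k h 0 psi hs hode hh
              ltac:(nra) (Rle_refl 0) ltac:(destruct hk; nra) t ht) as [ne [tau htau]].
  split; [apply (proj1 hs); lra | split; [exact ne|]].
  exists tau; eexists; split; [exact htau|].
  rewrite Rmult_0_l, exp_0; field.
- intros hk; split; [exact hs|]; intros t ht.
  apply (interior_fixed_point A B k h psi hs hode hh); [destruct hk; nra | exact ht].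
Qed.
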